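(* Let $G$ be a discrete Abelian group, let $M\ge 0$, and let $A\subset G$ satisfy $\|1_A\|_{B(G)}\le M$. Then $A$ is $(c_0\exp(\pi M)+1)$-stable, where $c_0:=2^{-4}\exp(-\gamma)\pi=0.110\dots$ and $\gamma$ is the Euler–Mascheroni constant.
   Context: For $k\in\mathbb{N}$, a set $A\subset G$ has the $k$-order property if there are vectors $a,b\in G^k$ such that for all $1\le i,j\le k$, $a_i+b_j\in A$ if and only if $i\le j$. For a real number $t$, $A$ is called $t$-stable if $A$ does not have the $k$-order property for any integer $k\ge t$ (equivalently, since the order property is monotone in $k$, $A$ does not have the $\lceil t\rceil$-order property). Let $\widehat{G}$ be the compact dual group of homomorphisms $G\to S^1=\{z\in\mathbb{C}:|z|=1\}$, and for a complex Radon measure $\mu\in M(\widehat{G})$ put $\widehat{\mu}(x)=\int\lambda(x)\,d\mu(\lambda)$ for $x\in G$. For $f:G\to\mathbb{C}$, $\|f\|_{B(G)}:=\int d|\mu|$ (the total variation of $\mu$) if $f=\widehat{\mu}$ for some (necessarily unique) $\mu\in M(\widehat{G})$, and $\|f\|_{B(G)}=\infty$ otherwise. $1_A$ denotes the indicator function of $A$. *)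

(* Defs.v *)
From HB Require Import structures.
From mathcomp Require Import all_boot all_order all_algebra.
From mathcomp Require Import complex.
From mathcomp Require Import all_classical all_reals all_analysis.

Set Implicit Arguments.
Unset Strict Implicit.
Unset Printing Implicit Defensive.

Import Order.TTheory GRing.Theory Num.Theory.
Import numFieldNormedType.Exports.

Local Open Scope classical_set_scope.
Local Open Scope ring_scope.
Local Open Scope complex_scope.

Section stability.
Variables (R : realType) (G : zmodType).

(* Indices run over 0, ..., k-1 instead of 1, ..., k. *)
Definition order_property (k : nat) (A : set G) : Prop :=
  exists a b : 'I_k -> G, forall i j : 'I_k, A (a i + b j) <-> (i <= j)%N.

Definition stable (t : R) (A : set G) : Prop :=
  forall k : nat, t <= k%:R -> ~ order_property k A.

End stability.

Section complex_measure.
Context (d : measure_display) (T : measurableType d) (R : realType).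

(* Charges of the library take finite values on measurable sets, so a pair of
   them is the same thing as a complex measure. *)
Record complex_measure := ComplexMeasure {
  re_charge : {charge set T -> \bar R};
  im_charge : {charge set T -> \bar R} }.

Definition cmeasure_val (mu : complex_measure) (E : set T) : R[i] :=
  fine (re_charge mu E) +i* fine (im_charge mu E).

(* |mu|(E), as a supremum over countable measurable partitions of E. *)
Definition cmeasure_variation (mu : complex_measure) (E : set T) : \bar R :=
  ereal_sup [set s | exists F : (set T)^nat,
    [/\ forall n, measurable (F n), trivIset [set: nat] F,
        \bigcup_n F n = E &
        s = (\sum_(0 <= n <oo)
               (ComplexField.Normc.normc (cmeasure_val mu (F n)))%:E)%E]].

Definition hahn_pair (nu : {charge set T -> \bar R}) :
    {PN : set T * set T | hahn_decomposition nu PN.1 PN.2} :=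
  let: exist P exN := cid (Hahn_decomposition nu) in
  let: exist N nuPN := cid exN in
  exist _ (P, N) nuPN.

Definition charge_integral (nu : {charge set T -> \bar R}) (f : T -> R) : R :=
  \int[jordan_pos (svalP (hahn_pair nu))]_x f x -
  \int[jordan_neg (svalP (hahn_pair nu))]_x f x.

Definition cmeasure_integral (mu : complex_measure) (f : T -> R[i]) : R[i] :=
  (charge_integral (re_charge mu) (fun x => complex.Re (f x)) -
   charge_integral (im_charge mu) (fun x => complex.Im (f x))) +i*
  (charge_integral (re_charge mu) (fun x => complex.Im (f x)) +
   charge_integral (im_charge mu) (fun x => complex.Re (f x))).

End complex_measure.

Notation borel T := (g_sigma_algebraType (@open T)).

(* On a compact Hausdorff space, mu is Radon iff |mu| is outer regular with
   respect to open sets and inner regular with respect to compact sets. *)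
Definition radon (T : ptopologicalType) (R : realType)
    (mu : complex_measure (borel T) R) : Prop :=
  forall E : set (borel T), measurable E ->
    cmeasure_variation mu E =
      ereal_inf [set cmeasure_variation mu U | U in
                   [set U : set T | open U /\ E `<=` U]] /\
    cmeasure_variation mu E =
      ereal_sup [set cmeasure_variation mu K | K in
                   [set K : set T | compact K /\ K `<=` E]].

Section dual_group.
Variables (R : realType) (G : zmodType).

Definition characters : set {ptws G -> R[i]^o} :=
  [set chi | (forall x y : G, chi (x + y) = chi x * chi y) /\
             (forall x : G, `|chi x| = 1)].

(* All homomorphisms of G to the unit circle, with the topology of pointwise
   convergence (which is the compact-open topology, G being discrete). *)
Definition dual_group : Type := set_type characters.

HB.instance Definition _ := Topological.on dual_group.

Lemma trivial_characterP : characters (fun=> 1).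
Proof. by split=> [x y|x]; rewrite ?mulr1 ?normr1. Qed.

HB.instance Definition _ := isPointed.Build dual_group
  (SigSub (mem_set trivial_characterP)).

Definition eval_character (x : G) (chi : dual_group) : R[i] := set_val chi x.

End dual_group.

Arguments dual_group : clear implicits.

Section fourier_stieltjes.
Variables (R : realType) (G : zmodType).

Let M := complex_measure (borel (dual_group R G)) R.

Definition fourier_stieltjes (mu : M) (x : G) : R[i] :=
  cmeasure_integral mu (eval_character x).

(* The measure mu is unique (on Borel sets), so that its choice is
   immaterial. *)
Definition B_norm (f : G -> R[i]) : \bar R :=
  if pselect (exists mu : M, radon mu /\ fourier_stieltjes mu = f) is left h
  then cmeasure_variation (sval (cid h)) [set: dual_group R G]
  else +oo%E.

End fourier_stieltjes.

Definition euler_mascheroni (R : realType) : R :=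
  lim ((fun n : nat => \sum_(1 <= k < n.+1) k%:R^-1 - ln n%:R) @ \oo).

Definition c0 (R : realType) : R := 2 ^- 4 * expR (- euler_mascheroni R) * pi.

(* Main.v *)
Require Import Defs.
From mathcomp Require Import all_boot all_order all_algebra.
From mathcomp Require Import complex.
From mathcomp Require Import all_classical all_reals all_analysis.
From mathcomp Require Import measurable_realfun ring lra.

Set Implicit Arguments.
Unset Strict Implicit.
Unset Printing Implicit Defensive.

Import Order.TTheory GRing.Theory Num.Theory.
Import numFieldNormedType.Exports.

Local Open Scope classical_set_scope.
Local Open Scope ring_scope.

(** Let T be the k x k matrix of the relation i <= j. If A has the k-order
    property through a and b, and 1_A is the Fourier-Stieltjes transform of mu,
    then T_ij is the integral of chi(a_i) chi(b_j) against mu, so for every real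
    matrix W the sum of the W_ij T_ij is at most the total variation of mu times
    the supremum over chi of the modulus of the sum of the W_ij chi(a_i) chi(b_j).
    For W the orthogonal factor of the polar decomposition of T that supremum is
    at most k, while the sum of the W_ij T_ij is the trace norm of T. The singular values of T are
    1 / (2 sin((2l+1) h)) with h = pi / (4k+2), hence

      k M >= (1/2) sum_(l < k) 1 / sin((2l+1) h).

    Writing 1/sin y = 1/y + g(y), the sum of the 1/y is an odd harmonic sum, which
    brings in gamma, and since g is nondecreasing the sum of the g((2l+1) h)
    dominates an integral of g, whose primitive is ln(tan(y/2) / (y/2)). The
    outcome is pi M > ln(k-1) + gamma + ln(16/pi), which is k - 1 < c0 exp(pi M). *)

(** * Singular vectors of the order matrix *)

Section order_matrix.
Variables (R : realType) (k : nat).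
Implicit Types (l m i j : nat).

(* For each [l < k] the vectors [lvec l] and [rvec l] are left and right singular
   vectors of the k x k matrix of the relation [i <= j], with singular value
   [(isv l)^-1]. *)
Definition angle l : R := l.*2.+1%:R * pi / k.*2.+1%:R.
Definition lvec l i : R := sin ((k%:R - i%:R) * angle l).
Definition rvec l i : R := cos ((k%:R - i%:R - 2^-1) * angle l).
Definition isv l : R := 2 * sin (angle l / 2).

Lemma angle_gt0 l : 0 < angle l.
Proof. by rewrite /angle divr_gt0 ?mulr_gt0 ?pi_gt0. Qed.

Lemma angle_lt_pi l : (l < k)%N -> angle l < pi.
Proof.
move=> lk; rewrite /angle ltr_pdivrMr// mulrC ltr_pM2l ?pi_gt0//.
by rewrite ltr_nat ltnS ltn_double.
Qed.

Lemma isv_gt0 l : (l < k)%N -> 0 < isv l.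
Proof.
move=> lk; rewrite mulr_gt0// sin_gt0_pi//.
by have := angle_gt0 l; have := angle_lt_pi lk; lra.
Qed.

(** The half angles lie in ]0, pi/2[, where sine is injective. Orthogonality of the singular vectors
    rests on this. *)
Lemma isv_inj l m : (l < k)%N -> (m < k)%N -> isv l = isv m -> l = m.
Proof.
move=> lk mk; rewrite /isv => /(mulfI (lt0r_neq0 (ltr0n R 2))) /sin_inj.
have := angle_gt0 l; have := angle_lt_pi lk.
have := angle_gt0 m; have := angle_lt_pi mk => m1 m2 l1 l2.
rewrite !in_itv/= => H; have : angle l / 2 = angle m / 2.
  by apply: H; apply/andP; split; lra.
move=> /(mulIf (invr_neq0 (lt0r_neq0 (ltr0n R 2)))); rewrite /angle.
move=> /(mulIf (invr_neq0 (lt0r_neq0 (ltr0n R k.*2.+1)))).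
move=> /(mulIf (lt0r_neq0 (pi_gt0 R))) /eqP.
by rewrite eqr_nat eqSS => /eqP /double_inj.
Qed.

Lemma lvec_gt0 l : (l < k)%N -> 0 < lvec l k.-1.
Proof.
move=> lk; rewrite /lvec -natrB ?leq_pred//.
have -> : (k - k.-1 = 1)%N by case: k lk => // n _; rewrite /= subSnn.
by rewrite mul1r sin_gt0_pi// angle_gt0 angle_lt_pi.
Qed.

(** Since 2 sin(t/2) cos c = sin(c + t/2) - sin(c - t/2), the sum telescopes; the boundary term at
    [j = k] is sin 0. *)
Lemma sum_rvec l i : (i < k)%N ->
  isv l * \sum_(j < k | (i <= j)%N) rvec l j = lvec l i.
Proof.
move=> ik; rewrite -(big_mkord (fun j => i <= j)%N).
rewrite (eq_bigl (fun j => xpredT j && (i <= j)%N))// -big_nat_widenl//.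
rewrite mulr_sumr (eq_bigr (fun j => (- lvec l j.+1) - (- lvec l j))).
  rewrite telescope_sumr ?(ltnW ik)// opprK addrC.
  by rewrite {2}/lvec subrr mul0r sin0 subr0.
move=> j _; rewrite /isv /rvec /lvec -(natr1 j).
set c := (X in cos X); set t := angle l.
have -> : (k%:R - (j%:R + 1)) * t = c - t / 2 by rewrite /c /t; field.
have -> : (k%:R - j%:R) * t = c + t / 2 by rewrite /c /t; field.
by rewrite sinB sinD; ring.
Qed.

Lemma cos_odd_pihalf l : cos (l.*2.+1%:R * pi / 2) = 0 :> R.
Proof.
elim: l => [|l IH]; first by rewrite mul1r cos_pihalf.
have -> : l.+1.*2.+1%:R * pi / 2 = l.*2.+1%:R * pi / 2 + pi :> R.
  by rewrite doubleS -!(natr1 _.+1) -!natr1; field.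
by rewrite cosDpi IH oppr0.
Qed.

(** The transposed telescoping. Its boundary term at [i = 0] is the cosine of an odd multiple of
    pi/2, which is why the angles are odd multiples of pi/(2k+1). *)
Lemma sum_lvec l j : (j < k)%N ->
  isv l * \sum_(i < k | (i <= j)%N) lvec l i = rvec l j.
Proof.
move=> jk; rewrite -(big_mkord (fun i => i <= j)%N).
rewrite (eq_bigl (fun i => xpredT i && (i < j.+1)%N))//.
rewrite -big_nat_widen//.
pose E n : R := cos ((k%:R - n%:R + 2^-1) * angle l).
rewrite mulr_sumr (eq_bigr (fun j => E j.+1 - E j)).
  rewrite telescope_sumr// {2}/E.
  have -> : (k%:R - 0%:R + 2^-1) * angle l = l.*2.+1%:R * pi / 2.
    rewrite /angle -(natr1 k.*2) -(mul2n k) natrM; field.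
    by rewrite -natrM natr1 pnatr_eq0.
  rewrite cos_odd_pihalf subr0 /E /rvec -(natr1 j); congr (cos (_ * _)); lra.
move=> i _; rewrite /E /isv /lvec -(natr1 i).
set d := (X in _ * sin X); set t := angle l.
have -> : (k%:R - (i%:R + 1) + 2^-1) * t = d - t / 2 by rewrite /d /t; field.
have -> : (k%:R - i%:R + 2^-1) * t = d + t / 2 by rewrite /d /t; field.
by rewrite cosB cosD; ring.
Qed.

(** Both sides come from one double sum, of [rvec l j * lvec m i] over [i <= j], evaluated in the
    two orders of summation. *)
Lemma lvec_rvec_dot l m : (l < k)%N -> (m < k)%N ->
  isv l * \sum_(j < k) rvec l j * rvec m j =
  isv m * \sum_(i < k) lvec l i * lvec m i.
Proof.
move=> lk mk; transitivity (isv l * isv m *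
    \sum_(j < k) \sum_(i < k | (i <= j)%N) rvec l j * lvec m i).
  rewrite -mulrA; congr (_ * _); rewrite mulr_sumr; apply: eq_bigr => j _.
  by rewrite -mulr_sumr mulrCA sum_lvec.
rewrite (mulrC (isv l)) -mulrA; congr (_ * _).
rewrite (exchange_big_dep xpredT)//= mulr_sumr; apply: eq_bigr => i _.
by rewrite -mulr_suml mulrA sum_rvec.
Qed.

(** Exchanging [l] and [m] in [lvec_rvec_dot] gives a second equation; together they make the
    difference of the squares of [isv l] and [isv m] annihilate [B]. *)
Lemma lvec_orth l m : (l < k)%N -> (m < k)%N -> l != m ->
  \sum_(i < k) lvec l i * lvec m i = 0.
Proof.
move=> lk mk lm.
set B := LHS; pose A : R := \sum_(i < k) rvec l i * rvec m i.
have H1 : isv l * A = isv m * B by exact: lvec_rvec_dot.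
have H2 : isv m * A = isv l * B.
  transitivity (isv m * \sum_(i < k) rvec m i * rvec l i).
    by congr (_ * _); apply: eq_bigr => i _; rewrite mulrC.
  rewrite lvec_rvec_dot//; congr (_ * _).
  by apply: eq_bigr => i _; rewrite mulrC.
have ll := isv_gt0 lk; have mm := isv_gt0 mk.
have : (isv l - isv m) * ((isv l + isv m) * B) = 0.
  transitivity (isv l * (isv l * B) - isv m * (isv m * B)); first by ring.
  by rewrite -H1 -H2; ring.
move=> /eqP; rewrite !mulf_eq0 subr_eq0 => /orP[/eqP /isv_inj E|/orP[|/eqP//]].
  by rewrite E ?eqxx in lm.
by move=> /eqP; lra.
Qed.

Lemma rvec_orth l m : (l < k)%N -> (m < k)%N -> l != m ->
  \sum_(i < k) rvec l i * rvec m i = 0.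
Proof.
move=> lk mk lm; have := lvec_rvec_dot lk mk; rewrite lvec_orth// mulr0.
by move=> /eqP; rewrite mulf_eq0 gt_eqF ?isv_gt0//= => /eqP.
Qed.

Definition sqn l : R := \sum_(i < k) lvec l i * lvec l i.

Lemma sqn_gt0 l : (l < k)%N -> 0 < sqn l.
Proof.
move=> lk; have k0 : (k.-1 < k)%N by case: k lk.
rewrite /sqn (bigD1 (Ordinal k0))//= ltr_wpDr//.
  by apply: sumr_ge0 => i _; rewrite -expr2 sqr_ge0.
by rewrite mulr_gt0 ?lvec_gt0.
Qed.

(** The case [m = l] of [lvec_rvec_dot]: both families share one normalisation. *)
Lemma sqn_rvec l : (l < k)%N -> \sum_(i < k) rvec l i * rvec l i = sqn l.
Proof.
by move=> lk; apply: (mulfI (lt0r_neq0 (isv_gt0 lk))); rewrite lvec_rvec_dot.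
Qed.

End order_matrix.

(** * Bessel's inequality for orthogonal families that are not normalised *)

Section bilinear_bound.
Variables (R : realFieldType) (I L : finType).
Implicit Types (e : L -> I -> R) (x : I -> R).

(** The squared distance from [x] to its projection on the span of [e] is nonnegative; the [c l] are
    the coefficients of that projection. *)
Lemma bessel e (n : L -> R) x : (forall l, 0 < n l) ->
  (forall l, \sum_i e l i * e l i = n l) ->
  (forall l m, l != m -> \sum_i e l i * e m i = 0) ->
  \sum_l (\sum_i e l i * x i) ^+ 2 / n l <= \sum_i x i ^+ 2.
Proof.
move=> n0 en eo; pose c l := (\sum_i e l i * x i) / n l.
have cn l : c l * n l = \sum_i e l i * x i by rewrite /c divfK ?gt_eqF.
have H1 : \sum_i (\sum_l c l * e l i) * x i = \sum_l c l ^+ 2 * n l.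
  under eq_bigr do rewrite mulr_suml.
  rewrite exchange_big/=; apply: eq_bigr => l _.
  under eq_bigr do rewrite -mulrA.
  by rewrite -mulr_sumr -cn expr2 mulrA.
have H2 : \sum_i (\sum_l c l * e l i) ^+ 2 = \sum_l c l ^+ 2 * n l.
  under eq_bigr do rewrite expr2 mulr_suml.
  rewrite exchange_big/=; apply: eq_bigr => l _.
  under eq_bigr do rewrite mulr_sumr.
  rewrite exchange_big/= (bigD1 l)//= [X in _ + X]big1 ?addr0.
    by rewrite -en mulr_sumr; apply: eq_bigr => i _; ring.
  move=> m ml; under eq_bigr do rewrite mulrACA.
  by rewrite -mulr_sumr eo ?mulr0// eq_sym.
have : 0 <= \sum_i (x i - \sum_l c l * e l i) ^+ 2.
  by apply: sumr_ge0 => i _; rewrite sqr_ge0.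
rewrite (eq_bigr (fun i => x i ^+ 2 - 2 * ((\sum_l c l * e l i) * x i) +
    (\sum_l c l * e l i) ^+ 2)); last by move=> i _; ring.
rewrite big_split sumrB -mulr_sumr H1 H2 /=.
rewrite (eq_bigr (fun l => (\sum_i e l i * x i) ^+ 2 / n l)); first lra.
by move=> l _; rewrite /c; field; rewrite gt_eqF.
Qed.

End bilinear_bound.

(** * The orthogonal test matrix *)

Section test_matrix.
Variables (R : realType) (k : nat).

(* The orthogonal factor of the polar decomposition of the matrix of [i <= j]. *)
Definition testmx (i j : nat) : R :=
  \sum_(l < k) lvec R k l i * rvec R k l j / sqn R k l.

(** Summing [rvec l j] over [j >= i] gives [lvec l i / isv l]; the remaining sum over [i] is
    [sqn l], which cancels the normalisation. *)
Lemma sum_testmx :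
  \sum_(i < k) \sum_(j < k | (i <= j)%N) testmx i j =
  \sum_(l < k) (isv R k l)^-1.
Proof.
under eq_bigr do rewrite exchange_big.
rewrite exchange_big/=; apply: eq_bigr => l _.
transitivity (\sum_(i < k) lvec R k l i * lvec R k l i / (isv R k l * sqn R k l)).
  apply: eq_bigr => i _; rewrite -mulr_suml -mulr_sumr -{2}sum_rvec//.
  by field; rewrite !gt_eqF ?sqn_gt0 ?isv_gt0.
rewrite -mulr_suml -/(sqn R k l); field.
by rewrite !gt_eqF ?sqn_gt0 ?isv_gt0.
Qed.

(** The two sums are the real and imaginary parts of x^T W y for x = xr + i xi and y = yr + i yi.
    Both vectors have norm sqrt k and W is a contraction by Bessel, so the modulus is at most k. *)
Lemma testmx_bound (xr xi yr yi : 'I_k -> R) :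
  (forall i, xr i ^+ 2 + xi i ^+ 2 = 1) ->
  (forall j, yr j ^+ 2 + yi j ^+ 2 = 1) ->
  (\sum_(i < k) \sum_(j < k) testmx i j * (xr i * yr j - xi i * yi j)) ^+ 2 +
  (\sum_(i < k) \sum_(j < k) testmx i j * (xr i * yi j + xi i * yr j)) ^+ 2
    <= k%:R ^+ 2.
Proof.
move=> x1 y1.
have [k0|k0] := posnP k.
  have no : 'I_k -> False by case=> m; rewrite {1}k0.
  by rewrite !big1 ?expr0n ?addr0 ?exprn_ge0// => i; case: (no i).
have {}k0 : 0 < k%:R :> R by rewrite ltr0n.
pose n (l : 'I_k) := sqn R k l.
have n0 l : 0 < n l by rewrite sqn_gt0.
pose P x (l : 'I_k) := \sum_(i < k) lvec R k l i * x i.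
pose Q y (l : 'I_k) := \sum_(i < k) rvec R k l i * y i.
(* In the coordinates [P] and [Q] along the singular vectors the bilinear form is diagonal. *)
have PQ x y : \sum_(i < k) \sum_(j < k) testmx i j * (x i * y j) =
    \sum_l P x l * Q y l / n l.
  under eq_bigr do under eq_bigr do rewrite mulr_suml.
  under eq_bigr do rewrite exchange_big.
  rewrite exchange_big/=; apply: eq_bigr => l _.
  rewrite -mulrA mulr_suml; apply: eq_bigr => i _.
  rewrite /Q mulr_suml mulr_sumr; apply: eq_bigr => j _.
  by rewrite /n; field; rewrite gt_eqF ?sqn_gt0.
have HP x : \sum_l P x l ^+ 2 / n l <= \sum_i x i ^+ 2.
  apply: (@bessel _ _ _ (fun l i : 'I_k => lvec R k l i)) => // l m lm.
  by rewrite lvec_orth.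
have HQ y : \sum_l Q y l ^+ 2 / n l <= \sum_i y i ^+ 2.
  apply: (@bessel _ _ _ (fun l i : 'I_k => rvec R k l i)) => //.
    by move=> l; rewrite sqn_rvec.
  by move=> l m lm; rewrite rvec_orth.
have sumk (f : 'I_k -> R) : (forall i, f i = 1) -> \sum_i f i = k%:R.
  by move=> f1; under eq_bigr do rewrite f1; rewrite sumr_const card_ord.
pose a := P xr; pose b := P xi; pose c := Q yr; pose d := Q yi.
have HP' : \sum_l (a l ^+ 2 + b l ^+ 2) / n l <= k%:R.
  rewrite -(sumk _ x1); under eq_bigr do rewrite mulrDl.
  by rewrite !big_split; apply: lerD; [exact: HP|exact: HP].
have HQ' : \sum_l (c l ^+ 2 + d l ^+ 2) / n l <= k%:R.
  rewrite -(sumk _ y1); under eq_bigr do rewrite mulrDl.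
  by rewrite !big_split; apply: lerD; [exact: HQ|exact: HQ].
set u := \sum_(i < k) _; set v := \sum_(i < k) _.
have uE : u = \sum_l (a l * c l - b l * d l) / n l.
  rewrite /u; under eq_bigr do (under eq_bigr do rewrite mulrBr; rewrite sumrB).
  by rewrite sumrB !PQ -sumrB; apply: eq_bigr => l _; rewrite -mulrBl.
have vE : v = \sum_l (a l * d l + b l * c l) / n l.
  rewrite /v; under eq_bigr do (under eq_bigr do rewrite mulrDr; rewrite big_split).
  by rewrite big_split/= !PQ -big_split; apply: eq_bigr => l _; rewrite /= -mulrDl.
(* With N = |u + iv|^2, the inequality 2XY <= k X^2 + Y^2 / k gives
   2N <= k^2 + N. *)
set N := u ^+ 2 + v ^+ 2.
have N0 : 0 <= N by rewrite addr_ge0 ?sqr_ge0.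
have NE : N = \sum_l (c l * (u * a l + v * b l) + d l * (v * a l - u * b l)) / n l.
  rewrite /N !expr2 {2}uE {2}vE !mulr_sumr -big_split; apply: eq_bigr => l _ /=.
  by rewrite !mulrA -mulrDl; congr (_ / _); ring.
suff : 2 * N <= k%:R * k%:R + N / k%:R * k%:R.
  by rewrite divfK ?gt_eqF// expr2; lra.
apply: (@le_trans _ _ (k%:R * (\sum_l (c l ^+ 2 + d l ^+ 2) / n l) +
    N / k%:R * (\sum_l (a l ^+ 2 + b l ^+ 2) / n l))); last first.
  by rewrite lerD// ler_wpM2l// ?divr_ge0// ltW.
rewrite {1}NE !mulr_sumr -big_split; apply: ler_sum => l _ /=.
rewrite !mulrA -mulrDl ler_wpM2r ?invr_ge0 ?(ltW (n0 l))//.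
rewrite -subr_ge0; set z := (X in 0 <= X).
(* Completing squares, with (ua + vb)^2 + (va - ub)^2 = N (a^2 + b^2). *)
have -> : z = ((k%:R * c l - (u * a l + v * b l)) ^+ 2 +
    (k%:R * d l - (v * a l - u * b l)) ^+ 2) / k%:R.
  by rewrite /z /N; field; rewrite gt_eqF.
by rewrite divr_ge0 ?addr_ge0 ?sqr_ge0// ltW.
Qed.

End test_matrix.

(** * Comparing cosecants with reciprocals *)

Section cosecant.
Variable R : realType.
Implicit Types x y t h a b : R.

Lemma sin_le_id t : 0 <= t -> sin t <= t.
Proof.
move=> t0.
have ds x : x \in `]0, t[%R -> is_derive x 1 sin (cos x).
  by move=> _; exact: is_derive_sin.
have [|c _] := MVT_segment t0 ds.
  by apply: continuous_subspaceT => x; exact: continuous_sin.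
by rewrite sin0 !subr0 => ->; rewrite ler_piMl ?cos_le1.
Qed.

Lemma mulr_cos_le_sin t : 0 <= t <= pi -> t * cos t <= sin t.
Proof.
move=> /andP[t0 tpi]; pose f y : R := sin y - y * cos y.
have df y : is_derive y 1 f (y * sin y).
  rewrite /f; apply: is_derive_eq; rewrite /GRing.scale/=; ring.
suff : f 0 <= f t by rewrite /f sin0 mul0r subrr subr_ge0.
apply: (@ger0_derive1_ndecr R f 0 pi) => //.
- move=> y; rewrite in_itv/= => /andP[y0 ypi].
  rewrite derive1E; have /@derive_val -> := df y.
  by rewrite mulr_ge0 ?ltW// sin_gt0_pi ?y0.
- apply: continuous_subspaceT => y.
  by apply/differentiable_continuous/derivable1_diffP; case: (df y).
Qed.

Definition csc_excess y : R := (sin y)^-1 - y^-1.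

(** The derivative 1/z^2 - cos z / sin(z)^2 is nonnegative once z^2 cos z <= sin(z)^2, which follows
    from t cos t <= sin t at t = z/2. *)
Lemma csc_excess_nd x y : 0 < x -> x <= y -> y < pi ->
  csc_excess x <= csc_excess y.
Proof.
move=> x0 xy ypi.
have dg z : 0 < z < pi ->
    is_derive z 1 csc_excess (- (sin z) ^- 2 * cos z - - z ^- 2).
  move=> /andP[z0 zpi]; have s0 : sin z != 0.
    by rewrite gt_eqF// sin_gt0_pi ?z0.
  have zn0 : z != 0 by rewrite gt_eqF.
  rewrite /csc_excess; apply: is_deriveB.
  by apply: is_derive_eq; [exact: is_deriveV | rewrite /GRing.scale/= mulr1].
apply: (@ger0_derive1_ndecr R csc_excess x y) => //.
- move=> z; rewrite in_itv/= => /andP[xz zy].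
  by have := dg z; rewrite (lt_trans x0 xz) (lt_trans zy ypi) => /(_ isT)[].
- move=> z; rewrite in_itv/= => /andP[xz zy].
  have z0 := lt_trans x0 xz; have zpi := lt_trans zy ypi.
  have dgz : is_derive z 1 csc_excess (- (sin z) ^- 2 * cos z - - z ^- 2).
    by apply: dg; rewrite z0.
  rewrite derive1E; have /@derive_val -> := dgz.
  have s0 : 0 < sin z by rewrite sin_gt0_pi ?z0.
  rewrite opprK mulNr addrC subr_ge0 mulrC ler_pdivrMr ?exprn_gt0//.
  rewrite mulrC ler_pdivlMr ?exprn_gt0//.
  set t := z / 2; have zt : z = t *+ 2 by rewrite /t -mulr_natr divfK.
  have tcs : t * cos t <= sin t by apply: mulr_cos_le_sin; rewrite /t; lra.
  have c0 : 0 <= cos t by apply: cos_ge0_pihalf; rewrite /t; lra.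
  have t0 : 0 <= t by rewrite /t; lra.
  rewrite zt sin_mulr2n cos_mulr2n.
  have := cos2Dsin2 t; move: tcs c0; set s := sin t; set c := cos t => tcs c0 cs1.
  have sge0 : 0 <= s := le_trans (mulr_ge0 t0 c0) tcs.
  have H : (t * c) ^+ 2 <= s ^+ 2.
    by rewrite ler_sqr ?nnegrE// (mulr_ge0 t0 c0).
  have H2 : 0 <= c ^+ 2 * (s ^+ 2 - (t * c) ^+ 2).
    by rewrite mulr_ge0 ?sqr_ge0// subr_ge0.
  have H3 := sqr_ge0 (t * s ^+ 2).
  rewrite -subr_ge0; set w := (X in 0 <= X).
  have -> : w = 4 * (c ^+ 2 * (s ^+ 2 - (t * c) ^+ 2)) + 4 * (t * s ^+ 2) ^+ 2.
    have s2 : s ^+ 2 = 1 - c ^+ 2 by rewrite -cs1; ring.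
    have -> : w = 4 * c ^+ 2 * s ^+ 2 - 4 * t ^+ 2 * (2 * c ^+ 2 - 1).
      by rewrite /w; ring.
    have -> : (t * s ^+ 2) ^+ 2 = t ^+ 2 * (s ^+ 2) ^+ 2 by ring.
    by rewrite s2; ring.
  by rewrite addr_ge0// mulr_ge0.
- apply: continuous_in_subspaceT => z; rewrite inE/= in_itv/= => /andP[xz zy].
  apply/differentiable_continuous/derivable1_diffP.
  by have := dg z; rewrite (lt_le_trans x0 xz) (le_lt_trans zy ypi) => /(_ isT)[].
Qed.

(* A primitive of [csc_excess], namely the logarithm of tan(y/2)/(y/2). *)
Definition csc_primitive y : R :=
  ln (sin (y / 2)) - ln (cos (y / 2)) - (ln y - ln 2).

Lemma is_derive_csc_primitive y : 0 < y < pi ->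
  is_derive y 1 csc_primitive (csc_excess y).
Proof.
move=> /andP[y0 ypi].
have s0 : 0 < sin (y / 2) by rewrite sin_gt0_pi//; lra.
have c0 : 0 < cos (y / 2) by rewrite cos_gt0_pihalf//; lra.
rewrite /csc_primitive /csc_excess.
have dh : is_derive y 1 (fun z : R => z / 2) 2^-1.
  by apply: is_derive_eq; rewrite /GRing.scale/= mulr1 ?mulr0 ?addr0 ?add0r.
have ds : is_derive y 1 (fun z : R => ln (sin (z / 2)))
    ((sin (y / 2))^-1 * (cos (y / 2) * 2^-1)).
  have H := is_derive1_comp (g := fun z => z / 2) (is_derive_sin (y / 2)) dh.
  exact: (is_derive1_comp (g := fun z => sin (z / 2)) (is_derive1_ln s0) H).
have dc : is_derive y 1 (fun z : R => ln (cos (z / 2)))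
    ((cos (y / 2))^-1 * (- sin (y / 2) * 2^-1)).
  have H := is_derive1_comp (g := fun z => z / 2) (is_derive_cos (y / 2)) dh.
  exact: (is_derive1_comp (g := fun z => cos (z / 2)) (is_derive1_ln c0) H).
have dl : is_derive y 1 (fun z : R => ln z - ln 2) y^-1.
  by have := is_deriveB (is_derive1_ln y0) (is_derive_cst (ln 2) y 1); rewrite subr0.
apply: is_derive_eq.
have -> : sin y = (cos (y / 2) * sin (y / 2)) *+ 2.
  by rewrite -sin_mulr2n; congr sin; field.
move: s0 c0 (cos2Dsin2 (y / 2)); set s := sin _; set c := cos _ => s0 c0 cs1.
congr (_ - _).
transitivity ((c ^+ 2 + s ^+ 2) / (c * s *+ 2)); last by rewrite cs1 mul1r.
by field; rewrite !gt_eqF.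
Qed.

(** Mean value theorem, with [csc_excess] at the intermediate point at most its value at [b]: a
    right-endpoint Riemann bound. *)
Lemma csc_primitive_step a b : 0 < a -> a <= b -> b < pi ->
  csc_primitive b - csc_primitive a <= csc_excess b * (b - a).
Proof.
move=> a0 ab bpi.
have dF x : x \in `]a, b[%R -> is_derive x 1 csc_primitive (csc_excess x).
  rewrite in_itv/= => /andP[ax xb]; apply: is_derive_csc_primitive.
  by rewrite (lt_trans a0 ax) (lt_trans xb bpi).
have [|c] := MVT_segment ab dF.
  apply: continuous_in_subspaceT => z; rewrite inE/= in_itv/= => /andP[az zb].
  apply/differentiable_continuous/derivable1_diffP.
  have := @is_derive_csc_primitive z.
  by rewrite (lt_le_trans a0 az) (le_lt_trans zb bpi) => /(_ isT)[].
rewrite in_itv/= => /andP[ac cb] ->; rewrite ler_wpM2r ?subr_ge0//.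
by apply: csc_excess_nd => //; rewrite (lt_le_trans a0 ac).
Qed.

Lemma ln_le_subr1 x : 0 < x -> ln x <= x - 1.
Proof.
move=> x0; have -> : ln x = ln (1 + (x - 1)) by congr ln; ring.
by apply: le_ln1Dx; lra.
Qed.

(** The corresponding bound from 0 to [h], the primitive having limit 0 at 0. The factor 2 gives
    this term the same weight as the later ones. Applying ln z <= z - 1 reduces the claim to sin x
    <= x and cos x <= 1 for x = h/2. *)
Lemma csc_primitive_init h : 0 < h < pi ->
  csc_primitive h <= 2 * h * csc_excess h.
Proof.
move=> /andP[h0 hpi]; rewrite /csc_primitive /csc_excess.
set x := h / 2; have hx : h = x *+ 2 by rewrite /x -mulr_natr divfK.
have x0 : 0 < x by rewrite /x; lra.
have s0 : 0 < sin x by rewrite sin_gt0_pi// /x; lra.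
have c0 : 0 < cos x by rewrite cos_gt0_pihalf// /x; lra.
have sx := sin_le_id (ltW x0).
have c1 := cos_le1 x.
have sE : sin h = 2 * (cos x * sin x) by rewrite hx sin_mulr2n; ring.
have -> : ln (sin x) - ln (cos x) - (ln h - ln 2) = ln (sin x / cos x / x).
  by rewrite [in RHS]ln_div ?posrE ?divr_gt0// !ln_div ?posrE.
apply: (le_trans (ln_le_subr1 _)); first by rewrite !divr_gt0.
rewrite sE; move: s0 c0 sx c1 sE; set s := sin x; set c := cos x => s0 c0 sx c1 _.
rewrite -subr_ge0; set w := (X in 0 <= X).
have -> : w = (2 * x ^+ 2 - s ^+ 2 - x * s * c) / (x * s * c).
  by rewrite /w hx; field; rewrite !gt_eqF.
have x0' := ltW x0; have s0' := ltW s0; have c0' := ltW c0.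
have H1 : s ^+ 2 <= x ^+ 2 by rewrite ler_sqr ?nnegrE.
have H2 : x * s * c <= x * x * 1.
  by apply: ler_pM => //; [exact: mulr_ge0|exact: ler_wpM2l].
apply: divr_ge0; last exact: mulr_ge0 (mulr_ge0 x0' s0') c0'.
by move: H1 H2; rewrite !expr2 mulr1; lra.
Qed.

(** Consecutive odd multiples of [h] are [2 * h] apart: [csc_primitive_init] serves the first point
    and one [csc_primitive_step] each later one. *)
Lemma csc_primitive_sum h n : 0 < h -> n.*2.+1%:R * h < pi ->
  csc_primitive (n.*2.+1%:R * h) <=
  2 * h * \sum_(l < n.+1) csc_excess (l.*2.+1%:R * h).
Proof.
move=> h0; elim: n => [|n IH] npi.
  by move: npi; rewrite big_ord1 !mul1r => hpi; apply: csc_primitive_init; rewrite h0.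
set b := (n.+1.*2.+1%:R * h) in npi *; set a := (n.*2.+1%:R * h) in IH.
have E : b = a + 2 * h.
  by rewrite /b /a doubleS -!(natr1 _.+1) -!natr1; ring.
have ab : a <= b by rewrite E lerDl mulr_ge0// ltW.
have a0 : 0 < a by rewrite mulr_gt0.
rewrite big_ord_recr/= -/b mulrDr.
have := csc_primitive_step a0 ab npi.
have := IH (le_lt_trans ab npi).
have -> : b - a = 2 * h by rewrite E; ring.
by rewrite (mulrC (csc_excess b)); lra.
Qed.

(** As tan(pi/4) = 1, only ln(4/pi) is left. *)
Lemma csc_primitive_pihalf : csc_primitive (pi / 2) = ln 2 *+ 2 - ln pi.
Proof.
rewrite /csc_primitive; have -> : pi / 2 / 2 = pi / 4 :> R by field.
have c0 : 0 < cos (pi / 4 : R).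
  by rewrite cos_gt0_pihalf//; have := pi_gt0 R; lra.
have := tan_piquarter R; rewrite /tan => /(congr1 ( *%R^~ (cos (pi / 4)))).
rewrite divfK ?gt_eqF// mul1r => ->.
by rewrite subrr ln_div ?posrE ?pi_gt0//; ring.
Qed.

End cosecant.

(** * The Euler-Mascheroni constant and odd harmonic sums *)

Section euler_mascheroni.
Variable R : realType.

Definition euler_seq (n : nat) : R := \sum_(1 <= k < n.+1) k%:R^-1 - ln n%:R.

Lemma ln_sub_le (x y : R) : 0 < x -> 0 < y -> ln x - ln y <= x / y - 1.
Proof.
by move=> x0 y0; rewrite -ln_div ?posrE// ln_le_subr1// divr_gt0.
Qed.

Lemma divr_succ_sub1 (a : R) : 0 < a -> a / (a + 1) - 1 = - (a + 1)^-1.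
Proof. by move=> a0; field; rewrite gt_eqF// addr_gt0. Qed.

(** From ln(n/(n+1)) <= -1/(n+1). The shift skips the term at 0, where the logarithm takes a default
    value. *)
Lemma euler_seq_nincr : nonincreasing_seq (fun n => euler_seq n.+1).
Proof.
apply/nonincreasing_seqP => n; rewrite /euler_seq (big_nat_recr n.+2)//=.
have n1 : 0 < n.+1%:R :> R by [].
have n2 : 0 < n.+2%:R :> R by [].
have := ln_sub_le n1 n2; rewrite -(natr1 n.+1) divr_succ_sub1//.
by lra.
Qed.

Lemma euler_seq_ge n : 1 - ln 2 <= euler_seq n.+1.
Proof.
(* Replacing ln(n+1) by ln(n+2) gives a nondecreasing sequence that starts at 1 - ln 2. *)
suff : 1 - ln 2 <= \sum_(1 <= k < n.+2) k%:R^-1 - ln n.+2%:R :> R.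
  move=> /le_trans; apply; rewrite lerD2l lerN2 ler_ln ?posrE//.
  by rewrite ler_nat.
elim: n => [|n IH]; first by rewrite big_nat1 invr1.
rewrite big_nat_recr//= (le_trans IH)//.
have n2 : 0 < n.+2%:R :> R by [].
have n3 : 0 < n.+3%:R :> R by [].
have := ln_sub_le n3 n2; rewrite -(natr1 n.+2).
rewrite mulrDl divff ?gt_eqF// mul1r => H; rewrite -addrA lerD2l.
by move: (n.+2%:R^-1) (ln (n.+2%:R + 1)) H => a b H; lra.
Qed.

Lemma cvg_euler_seq : euler_seq n @[n --> \oo] --> euler_mascheroni R.
Proof.
suff : cvgn (fun n => euler_seq n.+1).
  rewrite /euler_mascheroni -/euler_seq => /cvg_ex[l].
  rewrite (cvg_shiftS euler_seq) => cl; exact: (cvgP _ cl).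
apply: nonincreasing_is_cvgn; first exact: euler_seq_nincr.
by exists (1 - ln 2) => _ [n _ <-]; exact: euler_seq_ge.
Qed.

Lemma euler_mascheroni_le n : euler_mascheroni R <= euler_seq n.+1.
Proof.
have c : euler_seq n.+1 @[n --> \oo] --> euler_mascheroni R.
  by rewrite (cvg_shiftS euler_seq); exact: cvg_euler_seq.
rewrite -(cvg_lim (@Rhausdorff R) c).
exact: (nonincreasing_cvgn_ge euler_seq_nincr (cvgP _ c)).
Qed.

Lemma le_euler_mascheroni (x : R) (m : nat) :
  (forall n, (m <= n)%N -> x <= euler_seq n) -> x <= euler_mascheroni R.
Proof.
move=> H; rewrite -(cvg_lim (@Rhausdorff R) cvg_euler_seq).
apply: limr_ge; first exact: (cvgP _ cvg_euler_seq).
by exists m => // n /= mn; exact: H.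
Qed.

(** A crude numerical bound, used to make the logarithmic factor in [order_threshold] exceed 2. *)
Lemma euler_mascheroni_ge : 1 - ln 2 <= euler_mascheroni R.
Proof.
by apply: (@le_euler_mascheroni _ 1) => -[|n]// _; exact: euler_seq_ge.
Qed.

Definition odd_harmonic (n : nat) : R := \sum_(l < n.+1) l.*2.+1%:R^-1.

(** All reciprocals up to 2n+1, minus the even ones, which make half a harmonic sum. *)
Lemma odd_harmonicE n : 2 * odd_harmonic n =
  2 * \sum_(1 <= k < n.*2.+2) k%:R^-1 - \sum_(1 <= k < n.+1) k%:R^-1.
Proof.
rewrite /odd_harmonic; elim: n => [|n IH].
  by rewrite big_ord1 !big_nat1 big_geq// subr0.
rewrite big_ord_recr/= mulrDr IH doubleS !(big_nat_recr n.*2.+3)//=.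
rewrite !(big_nat_recr n.*2.+2)//= (big_nat_recr n.+1)//=.
have -> : n.*2.+2%:R = 2 * n.+1%:R :> R by rewrite -doubleS -muln2 natrM mulrC.
by rewrite invfM; move: (n.+1%:R^-1) (n.*2.+3%:R^-1) => a b; lra.
Qed.

(* [2 * odd_harmonic n - ln n - 2 * ln 2] decreases to [euler_mascheroni]. *)
Lemma odd_harmonic_ge n : (0 < n)%N ->
  euler_mascheroni R + ln n%:R + 2 * ln 2 <= 2 * odd_harmonic n.
Proof.
move=> n0; pose D n : R := 2 * odd_harmonic n - ln n%:R.
have Dnincr m : (0 < m)%N -> D m.+1 <= D m.
  move=> m0; have m1 : 0 < m%:R :> R by rewrite ltr0n.
  have m2 : 0 < m.+1%:R :> R by [].
  have := ln_sub_le m1 m2; rewrite /D /odd_harmonic big_ord_recr/= mulrDr.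
  have -> : m.+1.*2.+1%:R = 2 * m%:R + 3 :> R.
    by rewrite doubleS -muln2 -!natr1 natrM; ring.
  rewrite -(natr1 m) divr_succ_sub1//.
  suff : 2 * (2 * m%:R + 3)^-1 <= (m%:R + 1)^-1 :> R by lra.
  by rewrite ler_pdivrMr ?ler_pdivlMl; lra.
have DleD m : (n <= m)%N -> D m <= D n.
  elim: m => [|m IH]; first by rewrite leqn0 => /eqP ->.
  rewrite leq_eqVlt => /predU1P[->//|nm].
  by rewrite (le_trans _ (IH nm))// Dnincr// (leq_trans n0).
(* With H the harmonic numbers, [D m <= D n] and H_(2m) >= gamma + ln(2m) bound H_m - ln m below for
   all m >= n; its limit is gamma. *)
suff : 2 * euler_mascheroni R - (D n - 2 * ln 2) <= euler_mascheroni R.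
  by rewrite /D; lra.
apply: (@le_euler_mascheroni _ n) => m nm.
have m0 : (0 < m)%N by exact: leq_trans nm.
have := DleD _ nm; rewrite {1}/D odd_harmonicE (big_nat_recr m.*2.+1)//=.
have := euler_mascheroni_le m.*2.-1; rewrite prednK ?double_gt0// /euler_seq.
have -> : ln m.*2%:R = ln m%:R + ln 2 :> R.
  by rewrite -muln2 natrM lnM ?posrE ?ltr0n.
have : 0 <= m.*2.+1%:R^-1 :> R by rewrite invr_ge0.
by move: (m.*2.+1%:R^-1) => c; lra.
Qed.

End euler_mascheroni.

(** * From the trace norm to the bound on k *)

Section threshold.
Variable R : realType.

(** The odd harmonic sum provides ln k + gamma + 2 ln 2, and the integral of [csc_excess] up to pi/2
    provides 2 ln 2 - ln pi. *)
Lemma sum_isv_ge (k : nat) : (0 < k)%N ->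
  k.*2.+1%:R * (ln k%:R + euler_mascheroni R + 4 * ln 2 - ln pi) <=
  pi * (2 * \sum_(l < k) (isv R k l)^-1 + 1).
Proof.
(* Half of [angle l] is (2l+1) h, and the additional sample point [l = k] falls on pi/2, where the
   cosecant is 1; hence the [+ 1]. *)
move=> k0; pose h : R := pi / 2 / k.*2.+1%:R.
have h0 : 0 < h by rewrite !divr_gt0// pi_gt0.
have hE : k.*2.+1%:R * h = pi / 2 by rewrite mulrC divfK// pnatr_eq0.
pose C : R := \sum_(l < k) (isv R k l)^-1.
have pihalf_lt : pi / 2 < pi :> R by have := pi_gt0 R; lra.
have := @csc_primitive_sum R h k h0; rewrite hE => /(_ pihalf_lt).
have -> : \sum_(l < k.+1) csc_excess (l.*2.+1%:R * h) =
    2 * C + 1 - odd_harmonic R k / h.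
  rewrite /csc_excess sumrB; congr (_ - _); last first.
    by rewrite /odd_harmonic mulr_suml; apply: eq_bigr => l _; rewrite invfM.
  rewrite big_ord_recr/= hE sin_pihalf invr1; congr (_ + _).
  rewrite /C mulr_sumr; apply: eq_bigr => l _.
  have -> : l.*2.+1%:R * h = angle R k l / 2 by rewrite /h /angle; field.
  by rewrite /isv invfM mulVKf.
rewrite csc_primitive_pihalf.
have := odd_harmonic_ge R k0.
rewrite -/C; set H := odd_harmonic R k; set L1 := euler_mascheroni R.
have -> : 2 * h * (2 * C + 1 - H / h) = 2 * h * (2 * C + 1) - 2 * H.
  by field; rewrite gt_eqF.
move=> H1 H2.
have : ln k%:R + L1 + 4 * ln 2 - ln pi <= 2 * h * (2 * C + 1) by lra.
have -> : 2 * h = pi / k.*2.+1%:R by rewrite /h; field.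
by rewrite mulrAC ler_pdivlMr// mulrC.
Qed.

Lemma ln2_ge : 2^-1 <= ln 2 :> R.
Proof. by have := @ln_sub_le R 1 2; rewrite ln1 => /(_ ltr01 (ltr0n _ 2)); lra. Qed.

Lemma ln_c0 : ln (c0 R) = - (4 * ln 2) - euler_mascheroni R + ln pi.
Proof.
rewrite /c0 lnM ?posrE ?mulr_gt0 ?expR_gt0 ?pi_gt0 ?invr_gt0 ?exprn_gt0//.
rewrite lnM ?posrE ?expR_gt0 ?invr_gt0 ?exprn_gt0// expRK.
by rewrite lnV ?posrE ?exprn_gt0// lnXn// mulr_natl.
Qed.

Lemma c0_gt0 : 0 < c0 R.
Proof. by rewrite /c0 !mulr_gt0 ?expR_gt0 ?pi_gt0// invr_gt0 exprn_gt0. Qed.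

(** Suppose k - 1 >= c0 exp(pi M) and put L = ln k - ln c0. Then pi M <= L - 1/k, while [sum_isv_ge]
    gives (2k+1) L <= 2k pi M + pi. Together L <= pi - 2 < 2, but L > 2. *)
Lemma order_threshold (k : nat) (M : R) :
  \sum_(l < k) (isv R k l)^-1 <= k%:R * M -> k%:R < c0 R * expR (pi * M) + 1.
Proof.
move=> kM; rewrite ltNge; apply/negP => ck.
have cexp : 0 < c0 R * expR (pi * M) by rewrite mulr_gt0 ?c0_gt0 ?expR_gt0.
have k1 : 1 < k%:R :> R by lra.
have k2 : (1 < k)%N by rewrite -(ltr_nat R).
have k0 : 0 < k%:R :> R by lra.
have km : 0 < k%:R - 1 :> R by lra.
have H1 : ln (c0 R) + pi * M <= ln (k%:R - 1).
  rewrite -[X in _ + X]expRK -lnM ?posrE ?c0_gt0 ?expR_gt0//.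
  by rewrite ler_ln ?posrE//; lra.
have H2 := @sum_isv_ge k (ltnW k2).
have H3 := ln_sub_le km k0.
have H4 : ln 2 <= ln k%:R :> R by rewrite ler_ln ?posrE// ler_nat.
have H5 : ln pi < ln 4 :> R.
  by rewrite ltr_ln ?posrE ?pi_gt0//; have := pihalf_lt2 R; lra.
have ln4 : ln 4 = 2 * ln 2 :> R.
  have -> : 4 = 2 ^+ 2 :> R by ring.
  by rewrite lnXn// mulr_natl.
have H6 := euler_mascheroni_ge R; have H7 := ln2_ge; have H8 := pihalf_lt2 R.
have pi0 := pi_gt0 R.
rewrite ln_c0 in H1.
move: H2; set L := (X in _ * X); set C := \sum_(l < k) _ => H2.
have {}H3 : ln (k%:R - 1) <= ln k%:R - k%:R^-1 :> R.
  by move: H3; rewrite mulrBl divff ?gt_eqF// mul1r; lra.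
have piM : pi * M <= L - k%:R^-1 by rewrite /L; lra.
(* From ln k >= ln 2, gamma >= 1 - ln 2, ln pi < 2 ln 2 and ln 2 >= 1/2. *)
have L2 : 2 < L by rewrite /L; lra.
have kpiM : k%:R * (pi * M) <= k%:R * L - 1.
  apply: (le_trans (ler_wpM2l (ltW k0) piM)).
  by rewrite mulrBr divff ?gt_eqF.
have piC : pi * C <= pi * (k%:R * M) by rewrite ler_pM2l.
have E : pi * (k%:R * M) = k%:R * (pi * M) :> R by ring.
rewrite E in piC; move: H2; have -> : k.*2.+1%:R = 2 * k%:R + 1 :> R.
  by rewrite -natr1 -muln2 natrM mulrC.
have -> : (2 * k%:R + 1) * L = 2 * (k%:R * L) + L by ring.
have -> : pi * (2 * C + 1) = 2 * (pi * C) + pi by ring.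
by lra.
Qed.

End threshold.

(** * Integration of bounded functions against a charge *)

Section charge_integral.
Context (d : measure_display) (T : measurableType d) (R : realType).
Implicit Types (nu : {charge set T -> \bar R}) (f g : T -> R).

(** A class closed under linear combinations and integrable for every finite measure, so that
    [charge_integral] is linear on it. *)
Definition bounded_measurable f : Prop :=
  measurable_fun [set: T] f /\ exists C, forall x, `|f x| <= C.

Lemma bounded_measurable0 : bounded_measurable (fun=> 0).
Proof. by split; [exact: measurable_cst|exists 0 => x; rewrite normr0]. Qed.

Lemma bounded_measurableD f g :
  bounded_measurable f -> bounded_measurable g ->
  bounded_measurable (fun x => f x + g x).
Proof.
move=> [mf [C fC]] [mg [D gD]]; split; first exact: measurable_funD.
by exists (C + D) => x; rewrite (le_trans (ler_normD _ _))// lerD.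
Qed.

Lemma bounded_measurableZ (c : R) f :
  bounded_measurable f -> bounded_measurable (fun x => c * f x).
Proof.
move=> [mf [C fC]]; split; first exact: measurable_funM.
by exists (`|c| * C) => x; rewrite normrM ler_wpM2l.
Qed.

Lemma bounded_measurable_sum (I : finType) (F : I -> T -> R) :
  (forall i, bounded_measurable (F i)) ->
  bounded_measurable (fun x => \sum_i F i x).
Proof.
move=> bF; have [C HC] := choice (fun i => (bF i).2).
split; first by apply: measurable_sum => i; exact: (bF i).1.
exists (\sum_i C i) => x; apply: (le_trans (ler_norm_sum _ _ _)).
by apply: ler_sum => i _; exact: HC.
Qed.

Lemma bounded_measurable_indic (E : set T) : measurable E ->
  bounded_measurable (\1_E : T -> R).
Proof.
move=> mE; split; first exact: measurable_indic.
exists 1 => x; rewrite indicE; case: (x \in E); rewrite ?normr1 ?normr0//.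
Qed.

Lemma bounded_measurable_integrable (m : {finite_measure set T -> \bar R}) f :
  bounded_measurable f -> m.-integrable [set: T] (EFin \o f).
Proof.
move=> [mf [C fC]]; apply: measurable_bounded_integrable => //.
  by rewrite ltey_eq fin_num_measure.
exists C; split; first exact: num_real.
by move=> D CD x _ /=; rewrite (le_trans (fC x))// ltW.
Qed.

Let pos nu : {finite_measure set T -> \bar R} :=
  jordan_pos (svalP (hahn_pair nu)).
Let neg nu : {finite_measure set T -> \bar R} :=
  jordan_neg (svalP (hahn_pair nu)).

Lemma charge_integralD nu f g :
  bounded_measurable f -> bounded_measurable g ->
  charge_integral nu (fun x => f x + g x) =
  charge_integral nu f + charge_integral nu g.
Proof.
move=> bf bg; rewrite /charge_integral.
rewrite (@RintegralD _ _ _ (pos nu))// ?(@RintegralD _ _ _ (neg nu))//;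
  try exact: bounded_measurable_integrable.
ring.
Qed.

Lemma charge_integralZ nu (c : R) f : bounded_measurable f ->
  charge_integral nu (fun x => c * f x) = c * charge_integral nu f.
Proof.
move=> bf; rewrite /charge_integral.
rewrite (@RintegralZl _ _ _ (pos nu))// ?(@RintegralZl _ _ _ (neg nu))//;
  try exact: bounded_measurable_integrable.
ring.
Qed.

Lemma charge_integral0 nu : charge_integral nu (fun=> 0) = 0.
Proof.
by rewrite /charge_integral /Rintegral !integral0 subrr.
Qed.

Lemma charge_integral_sum nu (I : finType) (c : I -> R) (F : I -> T -> R) :
  (forall i, bounded_measurable (F i)) ->
  charge_integral nu (fun x => \sum_i c i * F i x) =
  \sum_i c i * charge_integral nu (F i).
Proof.
(* Boundedness of the partial sums is carried along, as additivity requires it. *)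
move=> bF; suff [//] : charge_integral nu (fun x => \sum_i c i * F i x) =
    \sum_i c i * charge_integral nu (F i) /\
    bounded_measurable (fun x => \sum_i c i * F i x).
elim: (index_enum I) => [|i r [IH br]].
  rewrite big_nil; have -> : (fun x => \sum_(i <- [::]) c i * F i x) = fun=> 0.
    by apply/funext => x; rewrite big_nil.
  by split; [exact: charge_integral0 | exact: bounded_measurable0].
rewrite big_cons; have -> : (fun x => \sum_(j <- i :: r) c j * F j x) =
    (fun x => c i * F i x + \sum_(j <- r) c j * F j x).
  by apply/funext => x; rewrite big_cons.
have bi := bounded_measurableZ (c i) (bF i).
split; last exact: bounded_measurableD.
by rewrite charge_integralD// charge_integralZ// IH.
Qed.

Lemma charge_integral_indic nu (E : set T) : measurable E ->
  charge_integral nu (\1_E : T -> R) = fine (nu E).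
Proof.
move=> mE; rewrite /charge_integral /Rintegral !integral_indic// !setIT.
rewrite (jordan_decomp (svalP (hahn_pair nu)) mE) /cadd/= cscaleN1.
by rewrite -(@fineN _ (neg nu E)) -fineD ?fin_numN ?fin_num_measure.
Qed.

Definition charge_mass nu : R := fine (pos nu setT) + fine (neg nu setT).

Lemma charge_mass_ge0 nu : 0 <= charge_mass nu.
Proof. by rewrite addr_ge0// fine_ge0. Qed.

Lemma charge_integral_le nu f (e : R) : measurable_fun setT f ->
  (forall x, `|f x| <= e) ->
  `|charge_integral nu f| <= e * charge_mass nu.
Proof.
move=> mf fe; have bf : bounded_measurable f by split => //; exists e.
have H (m : {finite_measure set T -> \bar R}) :
    `|\int[m]_x f x| <= e * fine (m setT).
  apply: le_trans (le_normr_Rintegral _ (bounded_measurable_integrable m bf)) _ => //.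
  rewrite -(@Rintegral_cst _ _ _ m setT measurableT e).
  apply: le_Rintegral => //.
    apply: bounded_measurable_integrable; split; first exact: measurableT_comp.
    by exists e => x; rewrite normr_id.
  apply: bounded_measurable_integrable; split; first exact: measurable_cst.
  by exists `|e|.
rewrite /charge_integral mulrDr (le_trans (ler_normB _ _))//.
by apply: lerD; [exact: (H (pos nu))|exact: (H (neg nu))].
Qed.

End charge_integral.

(** * Partitions on whose cells two functions are nearly constant *)

Section cells.
Context (d : measure_display) (T : measurableType d) (R : realType).

Lemma measurable_truncn_eq (w : T -> R) (n : nat) :
  measurable_fun setT w -> (forall x, 0 <= w x) ->
  measurable [set x | Num.truncn (w x) = n].
Proof.
move=> mw w0; have -> : [set x | Num.truncn (w x) = n] =
    setT `&` w @^-1` `[n%:R, n.+1%:R[%classic.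
  rewrite setTI; apply/seteqP; split => x /=; rewrite in_itv/= -truncn_eq//.
    by move=> ->.
  by move=> /eqP.
exact: mw.
Qed.

(** A grid of squares of side [e] covers the bounded range of (u, v), and the cells are the
    preimages of its squares. *)
Lemma measurable_fine_partition (u v : T -> R) (K e : R) :
  measurable_fun setT u -> measurable_fun setT v ->
  (forall x, `|u x| <= K) -> (forall x, `|v x| <= K) -> 0 < e ->
  exists (m : nat) (F : (set T)^nat),
    [/\ forall n, measurable (F n), trivIset [set: nat] F,
        (forall x, exists2 n, (n < m)%N & F n x) &
        forall n x y, F n x -> F n y ->
          `|u x - u y| <= e /\ `|v x - v y| <= e].
Proof.
move=> mu mv uK vK e0.
(* Shifting by [K] makes the argument nonnegative, where truncation is the floor. *)
pose s (w : T -> R) x := e^-1 * (w x + K).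
have ms w : measurable_fun setT w -> measurable_fun setT (s w).
  by move=> mw; apply: measurable_funM => //; exact: measurable_funD.
have s0 w : (forall x, `|w x| <= K) -> forall x, 0 <= s w x.
  move=> wK x; rewrite mulr_ge0 ?invr_ge0 ?(ltW e0)//.
  by have := wK x; rewrite ler_norml; lra.
pose B := (Num.truncn (e^-1 * (K + K))).+1.
have sB w : (forall x, `|w x| <= K) -> forall x, (Num.truncn (s w x) < B)%N.
  move=> wK x; rewrite ltnS; apply: le_truncn.
  rewrite ler_pM2l ?invr_gt0// lerD2r.
  by have := wK x; rewrite ler_norml; lra.
have sclose w x y : (forall x, `|w x| <= K) ->
    Num.truncn (s w x) = Num.truncn (s w y) -> `|w x - w y| <= e.
  move=> wK xy; have := truncn_itv (s0 w wK x); have := truncn_itv (s0 w wK y).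
  rewrite -xy -natr1; set t := (_)%:R => /andP[y1 y2] /andP[x1 x2].
  have : `|s w x - s w y| <= 1 by rewrite ler_norml; lra.
  have -> : s w x - s w y = e^-1 * (w x - w y) by rewrite /s; ring.
  by rewrite normrM gtr0_norm ?invr_gt0// ler_pdivrMl// mulr1.
(* Quotient and remainder by [B] encode a pair of grid indices; from [B * B] on the cells are
   empty. *)
pose F n := [set x | Num.truncn (s u x) = (n %/ B)%N] `&`
            [set x | Num.truncn (s v x) = (n %% B)%N].
exists (B * B)%N, F; split.
- by move=> n; apply: measurableI; apply: measurable_truncn_eq; auto.
- apply/trivIsetP => i j _ _ ij; apply/seteqP; split => // x [[a b] [c e']].
  by move/eqP: ij; apply; rewrite (divn_eq i B) (divn_eq j B) -a -b c e'.
- move=> x; exists (Num.truncn (s u x) * B + Num.truncn (s v x))%N.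
    have := sB u uK x; have := sB v vK x => h1 h2.
    rewrite (leq_trans (n := (Num.truncn (s u x)).+1 * B)) ?leq_mul2r ?h2 ?orbT//.
    by rewrite mulSn addnC ltn_add2r.
  by split; rewrite /= ?divnMDl// ?divn_small ?addn0 ?modnMDl ?modn_small ?sB.
- by move=> n x y [a b] [c e']; split; apply: sclose; rewrite // ?a ?b ?c ?e'.
Qed.

End cells.

(** * Integrals bounded by the total variation *)

Section complex_measure_bound.
Context (d : measure_display) (T : measurableType d) (R : realType).
Variable mu : complex_measure T R.

Lemma cmeasure_variation_ge (F : (set T)^nat) (m : nat) (M : R) :
  (forall n, measurable (F n)) -> trivIset [set: nat] F ->
  \bigcup_n F n = setT -> (cmeasure_variation mu setT <= M%:E)%E ->
  \sum_(n < m) ComplexField.Normc.normc (cmeasure_val mu (F n)) <= M.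
Proof.
move=> mF tF cF; rewrite -lee_fin; apply: le_trans.
apply: (@le_trans _ _ (\sum_(0 <= n <oo)
    (ComplexField.Normc.normc (cmeasure_val mu (F n)))%:E)%E); last first.
  by apply: ereal_sup_ubound; exists F.
rewrite -sumEFin -(big_mkord xpredT
  (fun n => (ComplexField.Normc.normc (cmeasure_val mu (F n)))%:E)).
apply: nneseries_lim_ge => n _ _; rewrite lee_fin.
by case: (cmeasure_val mu (F n)) => a b; rewrite /= sqrtr_ge0.
Qed.

(** The left side is Re((a + ib)(x + iy)); Lagrange's identity leaves the square (ay + bx)^2. *)
Lemma dot2_le (a b x y K : R) : 0 <= K -> a ^+ 2 + b ^+ 2 <= K ^+ 2 ->
  a * x - b * y <= K * Num.sqrt (x ^+ 2 + y ^+ 2).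
Proof.
move=> K0 abK; apply: (le_trans (ler_norm _)); rewrite -sqrtr_sqr.
have {1}-> : K = Num.sqrt (K ^+ 2) by rewrite sqrtr_sqr ger0_norm.
rewrite -sqrtrM ?sqr_ge0// ler_wsqrtr//.
have xy0 : 0 <= x ^+ 2 + y ^+ 2 by rewrite addr_ge0 ?sqr_ge0.
apply: le_trans (ler_wpM2r xy0 abK); rewrite -subr_ge0.
have -> : (a ^+ 2 + b ^+ 2) * (x ^+ 2 + y ^+ 2) - (a * x - b * y) ^+ 2 =
  (a * y + b * x) ^+ 2 by ring.
exact: sqr_ge0.
Qed.

(* The real part of the integral of [u + iv], bounded by approximating [u + iv]
   uniformly by simple functions whose values it takes. *)
Lemma Re_cmeasure_integral_le (u v : T -> R) (K M : R) :
  measurable_fun setT u -> measurable_fun setT v -> 0 <= K ->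
  (forall x, u x ^+ 2 + v x ^+ 2 <= K ^+ 2) ->
  (cmeasure_variation mu setT <= M%:E)%E ->
  charge_integral (re_charge mu) u - charge_integral (im_charge mu) v <= K * M.
Proof.
move=> mu' mv K0 uvK varM.
have sqK (x : R) y : x ^+ 2 + y ^+ 2 <= K ^+ 2 -> `|x| <= K.
  move=> h; rewrite -(ger0_norm K0) -ler_sqr ?nnegrE// !real_normK ?num_real//.
  by apply: le_trans h; rewrite lerDl sqr_ge0.
have uK x : `|u x| <= K by exact: sqK (uvK x).
have vK x : `|v x| <= K by apply: (sqK _ (u x)); rewrite addrC.
have bu : bounded_measurable u by split => //; exists K.
have bv : bounded_measurable v by split => //; exists K.
(* The tolerance is divided by the masses of both charges; the [+ 1] in [C] keeps the divisor
   positive. *)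
apply/ler_addgt0Pr => e e0.
pose C := charge_mass (re_charge mu) + charge_mass (im_charge mu) + 1.
have C0 : 0 < C by rewrite ltr_wpDl// addr_ge0// charge_mass_ge0.
have eC0 : 0 < e / C by rewrite divr_gt0.
have [m [F [mF tF cF Fe]]] := measurable_fine_partition mu' mv uK vK eC0.
(* On a nonempty cell take a value attained there, which obeys the bound [K]; on an empty one the
   default (0, 0). *)
have : forall n, exists ab : R * R, ab.1 ^+ 2 + ab.2 ^+ 2 <= K ^+ 2 /\
    forall x, F n x -> `|u x - ab.1| <= e / C /\ `|v x - ab.2| <= e / C.
  move=> n; have [[y Fy]|F0] := pselect (F n !=set0).
    by exists (u y, v y); split => //= x Fx; exact: Fe Fx Fy.
  exists (0, 0); split => /=; first by rewrite !expr0n/= addr0 sqr_ge0.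
  by move=> x Fx; case: F0; exists x.
move=> /choice[ab Hab].
pose s x := \sum_(n < m) (ab n).1 * (\1_(F n) x : R).
pose t x := \sum_(n < m) (ab n).2 * (\1_(F n) x : R).
have stE (c : nat -> R) n x : (n < m)%N -> F n x ->
    \sum_(i < m) c i * (\1_(F i) x : R) = c n.
  move=> nm Fx; rewrite (bigD1 (Ordinal nm))//= indicE mem_set// mulr1.
  rewrite big1 ?addr0// => i; rewrite -val_eqE/= => im.
  rewrite indicE memNset ?mulr0// => Fix_.
  move/trivIsetP : tF => /(_ i n Logic.I Logic.I im)/seteqP[/(_ x)+ _].
  by apply.
have bF (n : 'I_m) : bounded_measurable (\1_(F n) : T -> R).
  exact: bounded_measurable_indic.
have bs : bounded_measurable s.
  by apply: bounded_measurable_sum => n; exact: bounded_measurableZ.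
have bt : bounded_measurable t.
  by apply: bounded_measurable_sum => n; exact: bounded_measurableZ.
have split_int nu (f g : T -> R) : bounded_measurable f -> bounded_measurable g ->
    charge_integral nu f =
    charge_integral nu (fun x => f x - g x) + charge_integral nu g.
  move=> bf bg; rewrite -charge_integralD//.
    by congr charge_integral; apply/funext => x; rewrite subrK.
  have -> : (fun x => f x - g x) = fun x => f x + (-1) * g x.
    by apply/funext => x; rewrite mulN1r.
  by apply: bounded_measurableD => //; exact: bounded_measurableZ.
have close nu (f g : T -> R) : bounded_measurable f -> bounded_measurable g ->
    (forall x, `|f x - g x| <= e / C) ->
    `|charge_integral nu (fun x => f x - g x)| <= e / C * charge_mass nu.
  move=> [mf _] [mg _] fg; apply: charge_integral_le => //.
  exact: measurable_funB.
have us x : `|u x - s x| <= e / C.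
  have [n nm Fx] := cF x; rewrite /s (stE (fun n => (ab n).1) n)//.
  by have [] := (Hab n).2 x Fx.
have vt x : `|v x - t x| <= e / C.
  have [n nm Fx] := cF x; rewrite /t (stE (fun n => (ab n).2) n)//.
  by have [] := (Hab n).2 x Fx.
rewrite (split_int _ u s)// (split_int _ v t)//.
have := close (re_charge mu) u s bu bs us; have := close (im_charge mu) v t bv bt vt.
rewrite !ler_norml => /andP[i1 i2] /andP[r1 r2].
(* For simple functions the integral is a finite sum over cells, and [dot2_le] applies to each. *)
have simple : charge_integral (re_charge mu) s - charge_integral (im_charge mu) t
    <= K * M.
  rewrite /s /t !charge_integral_sum// -sumrB.
  have FT : \bigcup_n F n = setT.
    by apply/seteqP; split => // x _; have [n _ Fx] := cF x; exists n.
  apply: le_trans (ler_wpM2l K0 (cmeasure_variation_ge m mF tF FT varM)).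
  rewrite mulr_sumr; apply: ler_sum => n _.
  by rewrite !charge_integral_indic//=; apply: dot2_le => //; exact: (Hab n).1.
have eE : e / C * charge_mass (re_charge mu) + e / C * charge_mass (im_charge mu)
    <= e.
  rewrite -mulrDr -[leRHS](@divfK _ C) ?gt_eqF// ler_wpM2l ?(ltW eC0)// /C.
  by rewrite lerDl.
lra.
Qed.

End complex_measure_bound.

(** * Measurability of evaluations on the dual group *)

Section dual_measurability.
Local Open Scope complex_scope.
Variables (R : realType) (G : zmodType).


Lemma continuous_Re : continuous (@complex.Re R : R[i]^o -> R).
Proof.
move=> z A /nbhs_ballP[e /= e0 eA]; apply/nbhs_ballP.
exists e%:C => /=; first by rewrite ltcR.
move=> w; rewrite /ball/= => zw; apply: eA; rewrite /ball/=.
rewrite -ltcR (le_lt_trans _ zw)//.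
have -> : complex.Re z - complex.Re w = complex.Re (z - w).
  by case: z {zw}; case: w.
exact: normc_ge_Re.
Qed.

Lemma continuous_Im : continuous (@complex.Im R : R[i]^o -> R).
Proof.
have -> : (@complex.Im R : R[i]^o -> R) =
    (fun z => complex.Re (z : R[i]^o)) \o (fun z : R[i]^o => - 'i * z : R[i]^o).
  apply/funext => -[a b] /=; ring.
move=> z; apply: continuous_comp; last exact: continuous_Re.
exact: mulrl_continuous.
Qed.

(** Evaluation at [x] is a coordinate projection, continuous for pointwise convergence, so open
    intervals pull back to open sets. *)
Lemma measurable_eval (f : R[i]^o -> R) (x : G) : continuous f ->
  measurable_fun [set: borel (dual_group R G)] (fun chi => f (eval_character x chi)).
Proof.
move=> cf; apply: (measurability _ (RGenOpens.measurableE R)).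
move=> _ [_ [a [b ->] <-]]; rewrite setTI; apply: sub_sigma_algebra.
have : continuous (fun chi : dual_group R G => f (eval_character x chi)).
  move=> chi; apply: (@continuous_comp _ _ _
    (eval_character x : dual_group R G -> R[i]^o)); last exact: cf.
  apply: (@continuous_comp _ _ _
    (set_val : dual_group R G -> {ptws G -> R[i]^o}) (proj x)).
    exact: initial_continuous.
  exact: proj_continuous.
by move=> /continuousP; apply; exact: interval_open.
Qed.

End dual_measurability.

(** * The order property tested against a representing measure *)

Section fourier_stieltjes_bound.
Local Open Scope complex_scope.
Variables (R : realType) (G : zmodType).
Implicit Types (x y : G) (chi : dual_group R G).

Lemma eval_characterD x y chi :
  eval_character (x + y) chi = eval_character x chi * eval_character y chi.
Proof. by have [+ _] := set_valP chi; apply. Qed.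

Lemma eval_character_sqr x chi :
  complex.Re (eval_character x chi) ^+ 2 +
  complex.Im (eval_character x chi) ^+ 2 = 1.
Proof.
have [_ /(_ x) chi1] := set_valP chi.
have := add_Re2_Im2 (eval_character x chi).
by rewrite chi1 expr1n => /(congr1 (@complex.Re R)).
Qed.

Lemma bounded_measurable_Re_eval x :
  bounded_measurable (fun chi : borel (dual_group R G) =>
    complex.Re (eval_character x chi)).
Proof.
split; first exact: measurable_eval (@continuous_Re R).
exists 1 => chi; rewrite -(@ler_pXn2r _ 2)// ?nnegrE// real_normK ?num_real//.
by rewrite expr1n -(eval_character_sqr x chi) lerDl sqr_ge0.
Qed.

Lemma bounded_measurable_Im_eval x :
  bounded_measurable (fun chi : borel (dual_group R G) =>
    complex.Im (eval_character x chi)).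
Proof.
split; first exact: measurable_eval (@continuous_Im R).
exists 1 => chi; rewrite -(@ler_pXn2r _ 2)// ?nnegrE// real_normK ?num_real//.
by rewrite expr1n -(eval_character_sqr x chi) lerDr sqr_ge0.
Qed.

(** Integrating the sum of the W_ij chi(a_i + b_j) against [mu] selects the W_ij with [i <= j],
    which add up to the left side, while the integrand has modulus at most [k]. *)
Lemma order_property_sum_isv_le (mu : complex_measure (borel (dual_group R G)) R)
    (M : R) (A : set G) (k : nat) :
  (cmeasure_variation mu setT <= M%:E)%E ->
  fourier_stieltjes mu = (\1_A : G -> R[i]) ->
  order_property k A ->
  \sum_(l < k) (isv R k l)^-1 <= k%:R * M.
Proof.
move=> varM muA [a [b ab]].
pose W (p : 'I_k * 'I_k) : R := testmx R k p.1 p.2.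
pose ev (p : 'I_k * 'I_k) (chi : borel (dual_group R G)) :=
  eval_character (a p.1 + b p.2) chi.
pose u (chi : borel (dual_group R G)) := \sum_p W p * complex.Re (ev p chi).
pose v (chi : borel (dual_group R G)) := \sum_p W p * complex.Im (ev p chi).
have br p : bounded_measurable
    (fun chi : borel (dual_group R G) => complex.Re (ev p chi)).
  exact: bounded_measurable_Re_eval.
have bi p : bounded_measurable
    (fun chi : borel (dual_group R G) => complex.Im (ev p chi)).
  exact: bounded_measurable_Im_eval.
have [mu' _] : bounded_measurable u.
  by apply: bounded_measurable_sum => p; exact: bounded_measurableZ.
have [mv _] : bounded_measurable v.
  by apply: bounded_measurable_sum => p; exact: bounded_measurableZ.
(* Multiplicativity of [chi] puts the sum into the form of [testmx_bound]. *)
have uv chi : u chi ^+ 2 + v chi ^+ 2 <= k%:R ^+ 2.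
  have := @testmx_bound R k
    (fun i => complex.Re (eval_character (a i) chi))
    (fun i => complex.Im (eval_character (a i) chi))
    (fun j => complex.Re (eval_character (b j) chi))
    (fun j => complex.Im (eval_character (b j) chi)).
  move=> /(_ (fun i => eval_character_sqr _ _) (fun i => eval_character_sqr _ _)).
  rewrite !pair_bigA; congr (_ ^+ 2 + _ ^+ 2 <= _); apply: eq_bigr => p _.
    rewrite /ev eval_characterD.
    by case: (eval_character (a p.1) chi); case: (eval_character (b p.2) chi).
  rewrite /ev eval_characterD.
  by case: (eval_character (a p.1) chi); case: (eval_character (b p.2) chi).
have := Re_cmeasure_integral_le mu' mv (ler0n R k) uv varM.
rewrite !charge_integral_sum// -sumrB; apply: le_trans.
rewrite -(sum_testmx R k) (eq_bigr (fun i : 'I_k => \sum_(j < k)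
  testmx R k i j * (i <= j)%:R)); last first.
  move=> i _; rewrite big_mkcond; apply: eq_bigr => j _.
  by case: ifP; rewrite ?mulr1 ?mulr0.
rewrite pair_bigA le_eqVlt; apply/orP; left; apply/eqP; apply: eq_bigr => p _ /=.
rewrite -mulrBr; congr (_ * _).
(* The real part of the transform at a_i + b_j is the indicator of [A] there, which is 1 exactly
   when [i <= j]. *)
have := congr1 (fun f => complex.Re (f (a p.1 + b p.2))) muA.
rewrite /fourier_stieltjes /cmeasure_integral/= => ->.
rewrite indicE; have [h|h] := boolP (p.1 <= p.2)%N.
  by rewrite mem_set//; apply/ab.
by rewrite memNset// => /ab; apply/negP.
Qed.

End fourier_stieltjes_bound.

(** * Stability from the bound on the norm *)

Unset Implicit Arguments.

Theorem theorem1p8 (R : realType) (G : zmodType) (M : R) (hM : 0 <= M)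
  (A : set G) (hA : (B_norm (\1_A : G -> R[i]%C) <= M%:E)%E) :
  stable (c0 R * expR (pi * M) + 1) A.
Proof.
(* An infinite norm contradicts the bound by [M]; otherwise the norm is the variation of the chosen
   measure. *)
move: hA; rewrite /B_norm; case: pselect => [h|_]; last first.
  by rewrite leye_eq.
case: (cid h) => mu /= [_ muA] varM k tk opA.
have := order_threshold (order_property_sum_isv_le varM muA opA).
by rewrite ltNge tk.
Qed.
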